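(* Let $\mathbb{A}\in\mathbb{C}^{n\times n}$, let $\mathbf{X}_m,\mathbf{Y}_m\in\mathbb{C}^{n\times m}$ ($m\le n$) satisfy $\mathbf{Y}_m=\mathbb{A}\mathbf{X}_m$, let $\mathbf{X}_m=U\Sigma V^*$ be a thin singular value decomposition, let $k\in\{1,\ldots,m\}$ be such that $\sigma_k>0$, let $U_k,V_k,\Sigma_k$ be its truncation to the $k$ largest singular values, and let $B_k=\mathbf{Y}_mV_k\Sigma_k^{-1}$. Let $$\begin{pmatrix}U_k & B_k\end{pmatrix}=QR,\qquad R=\begin{pmatrix}R_{[11]}&R_{[12]}\\0&R_{[22]}\end{pmatrix}$$ be a QR factorization, where $R_{[11]},R_{[12]}$ are $k\times k$, $R_{[22]}$ is $k'\times k$ with $k'=\min(n-k,k)$, and for $\lambda\in\mathbb{C}$ define $$R_\lambda=\begin{pmatrix}R_{[12]}-\lambda R_{[11]}\\R_{[22]}\end{pmatrix}.$$ For a Ritz value $\lambda=\lambda_i$, i.e. an eigenvalue of $S_k=U_k^*B_k$, let $w_{\lambda_i}$ denote the (unit) right singular vector of the smallest singular value $\sigma_{\lambda_i}$ of $R_{\lambda_i}$. Then the vector $z_{\lambda_i}=U_kw_{\lambda_i}$ minimizes the residual $$\frac{\|\mathbb{A}z-\lambda_iz\|_2}{\|z\|_2}$$ over all $z\in\mathrm{range}(U_k)\setminus\{0\}$, and the minimal value equals $\sigma_{\lambda_i}=\|R_{\lambda_i}w_{\lambda_i}\|_2$.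
   Context: Thin SVD: $U\in\mathbb{C}^{n\times m}$ has orthonormal columns, $V\in\mathbb{C}^{m\times m}$ is unitary, $\Sigma=\mathrm{diag}(\sigma_1,\ldots,\sigma_m)$ with $\sigma_1\ge\cdots\ge\sigma_m\ge0$. $U_k,V_k$ consist of the first $k$ columns of $U,V$, and $\Sigma_k=\mathrm{diag}(\sigma_1,\ldots,\sigma_k)$. In the QR factorization, $Q$ is $n\times(k+k')$ with orthonormal columns and $R$ is upper triangular (upper trapezoidal if $k'<k$). The smallest singular value of the $(k+k')\times k$ matrix $R_\lambda$ is the smallest of its $k$ singular values. $\|\cdot\|_2$ is the Euclidean norm. *)

(* Defs.v *)
From mathcomp Require Import all_boot all_order all_algebra.
From mathcomp Require Import complex reals.

Set Implicit Arguments.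
Unset Strict Implicit.
Unset Printing Implicit Defensive.

Import Order.TTheory GRing.Theory Num.Theory.

Local Open Scope ring_scope.
Local Open Scope complex_scope.
Local Open Scope sesquilinear_scope.

Section Defs.
Variable R : realType.
Local Notation C := R[i].

Definition norm2 (n : nat) (v : 'cV[C]_n) : R :=
  Num.sqrt (\sum_i ComplexField.Normc.normc (v i 0) ^+ 2).

Definition orthonormal_cols (n m : nat) (U : 'M[C]_(n, m)) : Prop :=
  U^t* *m U = 1%:M.

Definition real_diag (m : nat) (s : 'rV[R]_m) : 'M[C]_m :=
  diag_mx (map_mx (real_complex R) s).

(* Meaningful for m <= n; orthonormal_cols U forces this. *)
Definition thin_svd (n m : nat) (X : 'M[C]_(n, m))
    (U : 'M[C]_(n, m)) (s : 'rV[R]_m) (V : 'M[C]_m) : Prop :=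
  [/\ orthonormal_cols U,
      V \is unitarymx,
      forall i j : 'I_m, (i <= j)%N -> s 0 j <= s 0 i,
      forall i : 'I_m, 0 <= s 0 i
    & X = U *m real_diag s *m V^t*].

(* For an n x m matrix with m <= n, the singular values are the m diagonal
   entries of a thin SVD (they do not depend on the SVD chosen). *)
Definition smallest_singular_value (n m : nat) (X : 'M[C]_(n, m)) (x : R) :
    Prop :=
  exists U s V, thin_svd X U s V /\
    (exists j : 'I_m, s 0 j = x) /\ (forall i : 'I_m, x <= s 0 i).

(* When a singular value is multiple its right singular vectors are not unique,
   even up to a phase; every unit one is a column of V in some thin SVD. *)
Definition right_singular_vector (n m : nat) (X : 'M[C]_(n, m)) (x : R)
    (w : 'cV[C]_m) : Prop :=
  exists U s V, thin_svd X U s V /\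
    exists j : 'I_m, s 0 j = x /\ w = col j V.

(* is_trig_mx means lower triangular (trapezoidal), whence the transpose. *)
Definition qr_factorization (n p q : nat) (M : 'M[C]_(n, q))
    (Q : 'M[C]_(n, p)) (T : 'M[C]_(p, q)) : Prop :=
  [/\ orthonormal_cols Q, is_trig_mx T^T & M = Q *m T].

Definition first_cols (n m k : nat) (hkm : (k <= m)%N) (M : 'M[C]_(n, m)) :
    'M[C]_(n, k) :=
  colsub (widen_ord hkm) M.

Definition first_sv (m k : nat) (hkm : (k <= m)%N) (s : 'rV[R]_m) : 'rV[R]_k :=
  colsub (widen_ord hkm) s.

Definition in_range_nonzero (n k : nat) (U : 'M[C]_(n, k)) (z : 'cV[C]_n) :
    Prop :=
  (exists c : 'cV[C]_k, z = U *m c) /\ z != 0.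

Definition residual (n : nat) (A : 'M[C]_n) (lambda : C) (z : 'cV[C]_n) : R :=
  norm2 (A *m z - lambda *: z) / norm2 z.

Definition minimizes (T : Type) (f : T -> R) (P : T -> Prop) (z : T) : Prop :=
  P z /\ forall y, P y -> f z <= f y.

End Defs.

(* Main.v *)
Require Import Defs.
From mathcomp Require Import all_boot all_order all_algebra.
From mathcomp Require Import complex reals.

Set Implicit Arguments.
Unset Strict Implicit.
Unset Printing Implicit Defensive.

Import Order.TTheory GRing.Theory Num.Theory.

Local Open Scope ring_scope.
Local Open Scope complex_scope.
Local Open Scope sesquilinear_scope.

(** The right singular vectors of [X] turn the data into the action of [A] on
    the left ones: [X V = U Sigma] gives [A U_k = Y V_k Sigma_k^-1 = B_k], where
    [Sigma_k] is invertible because its smallest entry is positive.  Hence for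
    [z = U_k c] the QR factorization yields

      [A z - lambda z = (B_k - lambda U_k) c = Q (R_lambda c)],

    and since [U_k] and [Q] have orthonormal columns they preserve the Euclidean
    norm ([norm2_orthonormal]), so the residual at [U_k c] is
    [|R_lambda c| / |c|] ([residual_eq]).  Minimizing the residual over the
    range of [U_k] is thus minimizing this quotient over nonzero [c], which is
    the variational characterization of the smallest singular value
    ([smallest_singular_value_le], [norm2_right_singular_vector]).  The two
    halves may use different decompositions [U Sigma V^*] of [R_lambda]: the
    lower bound [sigma |c| <= |R_lambda c|] is read in a decomposition where [sigma] is the
    least entry of [Sigma], and the equality at [w] in one where [w] is a column
    of [V]. *)

(** * The Euclidean norm *)

Lemma norm2_ge0 (R : realType) (n : nat) (v : 'cV[R[i]]_n) : 0 <= norm2 v.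
Proof. exact: sqrtr_ge0. Qed.

(** The algebraic form of the squared norm: it turns norm identities into
    matrix products. *)
Lemma norm2_sqr (R : realType) (n : nat) (v : 'cV[R[i]]_n) :
  (norm2 v ^+ 2)%:C = (v^t* *m v) 0 0.
Proof.
rewrite sqr_sqrtr; last by apply: sumr_ge0 => i _; exact: sqr_ge0.
rewrite mxE rmorph_sum /=; apply: eq_bigr => i _.
by rewrite !mxE rmorphXn /= mulrC -normCK.
Qed.

Lemma norm2_orthonormal (R : realType) (n m : nat) (M : 'M[R[i]]_(n, m))
    (v : 'cV[R[i]]_m) :
  orthonormal_cols M -> norm2 (M *m v) = norm2 v.
Proof.
move=> hM; apply/eqP; rewrite -(@eqrXn2 _ 2) ?norm2_ge0 //; apply/eqP.
apply: (@complexI R); rewrite !norm2_sqr.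
by rewrite trmx_mul map_mxM mulmxA -(mulmxA (v^t*)) hM mulmx1.
Qed.

Lemma norm2_eq0 (R : realType) (n : nat) (v : 'cV[R[i]]_n) :
  (norm2 v == 0) = (v == 0).
Proof.
apply/eqP/eqP => [h|->]; last first.
  by apply/eqP; rewrite -sqrf_eq0 -(inj_eq (@complexI R)) norm2_sqr mulmx0 mxE.
have := norm2_sqr v; rewrite h expr0n /= mxE => /esym/eqP.
rewrite psumr_eq0 => [/allP h0|i _]; last by rewrite !mxE mulrC -normCK exprn_ge0.
apply/matrixP => i j; rewrite ord1 [RHS]mxE; apply/eqP.
have := h0 i (mem_index_enum i).
by rewrite /= !mxE mulrC -normCK expf_eq0 normr_eq0.
Qed.

Lemma norm2_delta (R : realType) (n : nat) (j : 'I_n) (a : R) :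
  0 <= a -> norm2 (a%:C *: delta_mx j 0 : 'cV[R[i]]_n) = a.
Proof.
move=> a0; rewrite /norm2 (bigD1 j) //= big1 => [|i nij].
  by rewrite !mxE !eqxx mulr1 addr0 /= expr0n addr0 !sqrtr_sqr normr_id ger0_norm.
by rewrite !mxE (negPf nij) mulr0 ComplexField.Normc.normc0 expr0n.
Qed.

Lemma norm2_real_diag_ge (R : realType) (n : nat) (s : 'rV[R]_n) (x : R)
    (c : 'cV[R[i]]_n) :
  0 <= x -> (forall i, x <= s 0 i) ->
  x * norm2 c <= norm2 (real_diag s *m c).
Proof.
move=> x0 hx; rewrite -{1}(ger0_norm x0) -sqrtr_sqr -sqrtrM ?sqr_ge0 //.
rewrite ler_wsqrtr // mulr_sumr ler_sum // => i _.
rewrite mul_diag_mx !mxE ComplexField.Normc.normcM exprMn.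
rewrite ler_wpM2r ?sqr_ge0 // /= expr0n addr0 sqrtr_sqr.
by rewrite ler_sqr ?nnegrE // (le_trans (hx i)) // ler_norm.
Qed.

(** * Singular values *)

Lemma smallest_singular_value_ge0 (R : realType) (n m : nat)
    (X : 'M[R[i]]_(n, m)) (x : R) :
  smallest_singular_value X x -> 0 <= x.
Proof. by case=> [U [s [V [[_ _ _ s0 _] [[j <-] _]]]]]. Qed.

Lemma orthonormal_cols_unitary (R : realType) (m : nat) (V : 'M[R[i]]_m) :
  V \is unitarymx -> orthonormal_cols V /\ orthonormal_cols (V^t*).
Proof.
move=> /unitarymxP hV; split; last by rewrite /orthonormal_cols trmxCK.
exact: mulmx1C.
Qed.

(** The outer factors of the decomposition are isometries, which leaves a
    diagonal matrix with entries at least [x]. *)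
Lemma smallest_singular_value_le (R : realType) (n m : nat)
    (X : 'M[R[i]]_(n, m)) (x : R) (c : 'cV[R[i]]_m) :
  smallest_singular_value X x -> x * norm2 c <= norm2 (X *m c).
Proof.
move=> hx; have x0 := smallest_singular_value_ge0 hx.
case: hx => [U [s [V [[hU hV _ _ ->] [_ hs]]]]].
have [_ hVt] := orthonormal_cols_unitary hV.
by rewrite -!mulmxA norm2_orthonormal // -(norm2_orthonormal c hVt)
  norm2_real_diag_ge.
Qed.

(** In the singular bases [w] is a coordinate vector, so both norms can be read
    off. *)
Lemma norm2_right_singular_vector (R : realType) (n m : nat)
    (X : 'M[R[i]]_(n, m)) (x : R) (w : 'cV[R[i]]_m) :
  right_singular_vector X x w -> norm2 w = 1 /\ norm2 (X *m w) = x.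
Proof.
case=> [U [s [V [[hU hV _ s0 ->] [j [<- ->]]]]]].
have [hV1 _] := orthonormal_cols_unitary hV.
rewrite colE; split.
  rewrite norm2_orthonormal // -[delta_mx _ _]scale1r.
  exact: (norm2_delta _ ler01).
rewrite -!mulmxA norm2_orthonormal // (mulmxA (V^t*)) hV1 mul1mx.
rewrite -[RHS](norm2_delta j (s0 j)); congr norm2.
apply/matrixP => i l; rewrite mul_diag_mx !mxE.
by case: (eqVneq i j) => [->|] //=; rewrite !mulr0.
Qed.

(** * Truncating the decomposition *)

Lemma orthonormal_first_cols (R : realType) (n m k : nat) (hkm : (k <= m)%N)
    (U : 'M[R[i]]_(n, m)) :
  orthonormal_cols U -> orthonormal_cols (first_cols hkm U).
Proof.
move=> /matrixP hU; apply/matrixP => i j.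
have := hU (widen_ord hkm i) (widen_ord hkm j); rewrite !mxE => h.
by apply: etrans h; apply: eq_bigr => l _; rewrite !mxE.
Qed.

(** [V] being unitary, [X V = U Sigma]; as [Sigma] is diagonal, this identity
    restricts to the first [k] columns of each factor. *)
Lemma thin_svd_first_cols (R : realType) (n m k : nat) (hkm : (k <= m)%N)
    (X U : 'M[R[i]]_(n, m)) (s : 'rV[R]_m) (V : 'M[R[i]]_m) :
  thin_svd X U s V ->
  X *m first_cols hkm V = first_cols hkm U *m real_diag (first_sv hkm s).
Proof.
case=> [_ hV _ _ ->]; have [hV1 _] := orthonormal_cols_unitary hV.
have -> : U *m real_diag s *m V^t* *m first_cols hkm V
    = first_cols hkm (U *m real_diag s *m V^t* *m V).
  by apply/matrixP => i j; rewrite !mxE; apply: eq_bigr => l _; rewrite !mxE.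
rewrite -mulmxA hV1 mulmx1.
by apply/matrixP => i j; rewrite !mul_mx_diag !mxE.
Qed.

Lemma real_diag_unit (R : realType) (m : nat) (s : 'rV[R]_m) :
  (forall i, 0 < s 0 i) -> real_diag s \in unitmx.
Proof.
move=> s0; rewrite unitmxE det_diag unitfE; apply/prodf_neq0 => i _.
by rewrite mxE (inj_eq (@complexI R)) gt_eqF.
Qed.

Lemma first_sv_gt0 (R : realType) (m k : nat) (hkm : (k <= m)%N)
    (s : 'rV[R]_m) :
  (forall i j : 'I_m, (i <= j)%N -> s 0 j <= s 0 i) ->
  (forall i : 'I_m, i.+1 = k -> 0 < s 0 i) ->
  forall i, 0 < first_sv hkm s 0 i.
Proof.
move=> hs hsk i; rewrite mxE.
have k0 : (0 < k)%N by apply: leq_ltn_trans (ltn_ord i).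
have hl : (k.-1 < m)%N by rewrite prednK.
apply: (lt_le_trans (hsk (Ordinal hl) (prednK k0))); apply: hs => /=.
by rewrite -ltnS prednK.
Qed.

(** * The residual on the range of [U_k] *)

(** Comparing the two column blocks of the factorization gives
    [Uk = Q (R11; 0)] and [A Uk = Q (R12; R22)], so [A - lambda] maps [Uk c] to
    [Q] times the shifted block applied to [c], and [Q] is an isometry. *)
Lemma residual_eq (R : realType) (n k k' : nat) (A : 'M[R[i]]_n)
    (Uk : 'M[R[i]]_(n, k)) (Q : 'M[R[i]]_(n, k + k'))
    (R11 R12 : 'M[R[i]]_k) (R22 : 'M[R[i]]_(k', k)) (lambda : R[i])
    (c : 'cV[R[i]]_k) :
  orthonormal_cols Uk ->
  qr_factorization (row_mx Uk (A *m Uk)) Q (block_mx R11 R12 0 R22) ->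
  residual A lambda (Uk *m c)
    = norm2 (col_mx (R12 - lambda *: R11) R22 *m c) / norm2 c.
Proof.
move=> hU [hQ _ hM]; rewrite /residual (norm2_orthonormal c hU).
congr (_ / _); rewrite -(norm2_orthonormal _ hQ); congr norm2.
move: hM; rewrite block_mxEh mul_mx_row => /eq_row_mx [hUk hAUk].
have -> : col_mx (R12 - lambda *: R11) R22
    = col_mx R12 R22 - lambda *: col_mx R11 0.
  by rewrite scale_col_mx opp_col_mx add_col_mx scaler0 subr0.
by rewrite !mulmxA mulmxBr -scalemxAr -hAUk -hUk mulmxBl -scalemxAl.
Qed.

Unset Implicit Arguments.

Theorem proposition3p3 (R : realType) (n m k k' : nat)
  (hmn : (m <= n)%N) (hk0 : (0 < k)%N) (hkm : (k <= m)%N)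
  (hk' : k' = minn (n - k) k)
  (A : 'M[R[i]]_n) (X Y : 'M[R[i]]_(n, m)) (hY : Y = A *m X)
  (U : 'M[R[i]]_(n, m)) (s : 'rV[R]_m) (V : 'M[R[i]]_m)
  (hsvd : thin_svd X U s V)
  (hsk : forall i : 'I_m, i.+1 = k -> 0 < s 0 i)
  (Uk : 'M[R[i]]_(n, k)) (hUk : Uk = first_cols hkm U)
  (Vk : 'M[R[i]]_(m, k)) (hVk : Vk = first_cols hkm V)
  (Sigmak : 'M[R[i]]_k) (hSigmak : Sigmak = real_diag (first_sv hkm s))
  (Bk : 'M[R[i]]_(n, k)) (hBk : Bk = Y *m Vk *m invmx Sigmak)
  (Q : 'M[R[i]]_(n, k + k')) (R11 R12 : 'M[R[i]]_k) (R22 : 'M[R[i]]_(k', k))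
  (hQR : qr_factorization (row_mx Uk Bk) Q (block_mx R11 R12 0 R22))
  (Rl : R[i] -> 'M[R[i]]_(k + k', k))
  (hRl : forall lambda : R[i], Rl lambda = col_mx (R12 - lambda *: R11) R22)
  (lambda : R[i]) (hlambda : eigenvalue (Uk^t* *m Bk) lambda)
  (sigma : R) (hsigma : smallest_singular_value (Rl lambda) sigma)
  (w : 'cV[R[i]]_k) (hw : right_singular_vector (Rl lambda) sigma w) :
  minimizes (residual A lambda) (in_range_nonzero Uk) (Uk *m w) /\
  residual A lambda (Uk *m w) = sigma /\
  sigma = norm2 (Rl lambda *m w).
Proof.
case: (hsvd) => [hU _ hs _ _].
have hUo : orthonormal_cols Uk by rewrite hUk; exact: orthonormal_first_cols.
have hB : Bk = A *m Uk.
  have hS : Sigmak \in unitmx.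
    by rewrite hSigmak; exact/real_diag_unit/first_sv_gt0.
  rewrite hBk hY -(mulmxA A) hVk (thin_svd_first_cols _ hsvd).
  by rewrite -hSigmak -hUk mulmxA mulmxK.
rewrite hB in hQR.
have hres c : residual A lambda (Uk *m c) = norm2 (Rl lambda *m c) / norm2 c.
  by rewrite hRl; exact: residual_eq hUo hQR.
have nz_range (c : 'cV_k) : (Uk *m c != 0) = (c != 0).
  by rewrite -!norm2_eq0 norm2_orthonormal.
have [w1 hRw] := norm2_right_singular_vector hw.
have hresw : residual A lambda (Uk *m w) = sigma by rewrite hres w1 divr1.
split; last by [].
split; first split.
- by exists w.
- by rewrite nz_range -(norm2_eq0 w) w1 oner_eq0.
move=> _ [[c ->]]; rewrite nz_range -(norm2_eq0 c) => c0.
rewrite hresw hres ler_pdivlMr; last by rewrite lt_def c0 norm2_ge0.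
exact: smallest_singular_value_le.
Qed.
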